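(* Let $G=Q_{28}$ and let $P$ be the left ideal of $\mathbb{Z}Q_{28}$ generated by the two elements $-3+4y$ and $x+1$. Then $P$ is a stably free left $\mathbb{Z}Q_{28}$-module and $P$ is not a free $\mathbb{Z}Q_{28}$-module.
   Context: $Q_{28}=\langle x,y \mid x^7y^{-2},\ yxyx^{-6}\rangle$ is the generalized quaternion group of order $28$ (equivalently, $x^7=y^2$ and $yxy^{-1}=x^{-1}$), and $\mathbb{Z}Q_{28}$ is its integral group ring. A finitely generated left $\mathbb{Z}G$-module $P$ is stably free if $P\oplus\mathbb{Z}G^r\cong\mathbb{Z}G^s$ for some integers $r,s\ge 0$. *)

(* Defs.v *)
From HB Require Import structures.
From mathcomp Require Import all_boot all_order all_algebra all_fingroup.
From mathcomp Require Import finmap boolp ring.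

Set Implicit Arguments.
Unset Strict Implicit.
Unset Printing Implicit Defensive.

Import GRing.Theory.

(* G = < x, y | x^7 y^-2, y x y x^-6 >: the elements x and y generate G, they
   satisfy the two relators, and any pair (a, b) satisfying them in any group H
   (possibly infinite) is the image of (x, y) under a homomorphism G -> H. *)
Section Presentation.
Local Open Scope group_scope.

Definition Q28_relations (H : groupType) (a b : H) : Prop :=
  a ^+ 7 * b ^- 2 = 1 /\ b * a * b * a ^- 6 = 1.

Definition presents_Q28 (G : finGroupType) (x y : G) : Prop :=
  [/\ <<[set x; y]>> = [set: G],
      Q28_relations x y
    & forall (H : groupType) (a b : H), Q28_relations a b ->
        exists f : {multiplicative G -> H}, f x = a /\ f y = b].

End Presentation.

(* A group with this presentation exists: the pair (i, s) encodes x^i y^s with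
   i modulo 14 and s in {0, 1}. *)
Definition Q28_model : Type := ('Z_14 * bool)%type.
HB.instance Definition _ := Finite.on Q28_model.

Section Model.
Local Open Scope ring_scope.

Definition Q28_mul (u v : Q28_model) : Q28_model :=
  (u.1 + (if u.2 then - v.1 else v.1) + (if u.2 && v.2 then 7 else 0),
   u.2 (+) v.2).
Definition Q28_one : Q28_model := (0, false).
Definition Q28_inv (u : Q28_model) : Q28_model :=
  (if u.2 then u.1 + 7 else - u.1, u.2).

Let Z14_7 : (7 + 7 : 'Z_14) = 0. Proof. exact: val_inj. Qed.
Let Z14_N7 : (- 7 : 'Z_14) = 7. Proof. exact: val_inj. Qed.

Lemma Q28_mulA : associative Q28_mul.
Proof.
move=> [i a] [j b] [k c]; rewrite /Q28_mul /=; congr pair; last by rewrite addbA.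
by move: (7 : 'Z_14) Z14_N7 => z zN; case: a b c => [] [] [] /=;
  rewrite ?(opprD, oppr0, zN); ring.
Qed.

Lemma Q28_mul1 : left_id Q28_one Q28_mul.
Proof. by move=> [i a]; rewrite /Q28_mul /= addr0 add0r. Qed.

Lemma Q28_mulV : left_inverse Q28_one Q28_inv Q28_mul.
Proof.
move=> [i [|]]; rewrite /Q28_mul /Q28_inv /Q28_one /=.
  by rewrite (addrAC i) subrr add0r Z14_7.
by rewrite addNr addr0.
Qed.

End Model.

HB.instance Definition _ :=
  Finite_isGroup.Build Q28_model Q28_mulA Q28_mul1 Q28_mulV.

Section ModelPresentation.
Local Open Scope group_scope.

Let X : Q28_model := (1%R, false).
Let Y : Q28_model := (0%R, true).

Let expX n : X ^+ n = (n%:R%R, false).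
Proof.
elim: n => [//|n IHn]; rewrite expgS {}IHn; congr pair.
by rewrite /= addr0 -natr1 addrC.
Qed.

Let normal_form (u : Q28_model) : u = X ^+ (u.1 : nat) * Y ^+ (u.2 : nat).
Proof.
case: u => i s; rewrite expX natr_Zp.
by case: s; congr pair; rewrite /= !addr0.
Qed.

Lemma presents_Q28_model : presents_Q28 X Y.
Proof.
split=> [||H a b [Hr1 Hr2]].
- apply/setP=> u; rewrite inE (normal_form u).
  by rewrite groupM // groupX // mem_gen // !inE eqxx ?orbT.
- by split; apply/eqP; vm_compute.
have a7 : a ^+ 7 = b ^+ 2.
  by apply/eqP; rewrite -(can_eq (mulgK (b ^- 2))) Hr1 mulgV.
have bab : b * a * b = a ^+ 6.
  by apply/eqP; rewrite -(can_eq (mulgK (a ^- 6))) Hr2 mulgV.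
have ba : b * a = a^-1 * b.
  apply: (@mulIg _ b); rewrite bab -mulgA -[b * b]/(b ^+ 2) -a7.
  by rewrite (expgS a 6) mulKg.
have ban n : b * a ^+ n = a ^- n * b.
  elim: n => [|n IHn]; first by rewrite mulg1 invg1 mul1g.
  by rewrite expgSr mulgA IHn -mulgA ba mulgA -invgM -expgS expgSr.
have a14 : a ^+ 14 = 1.
  have E : a ^- 7 = a ^+ 7.
    by apply: (@mulIg _ b); rewrite -ban a7 -expgS -expgSr.
  by rewrite (expgD a 7 7) -{1}E mulVg.
pose f (u : Q28_model) : H := a ^+ (u.1 : nat) * b ^+ (u.2 : nat).
have amod n : a ^+ (n %% 14) = a ^+ n.
  by rewrite [in RHS](divn_eq n 14) expgD mulnC expgM a14 expg1n mul1g.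
have aD (i j : 'Z_14) : a ^+ (i + j)%R = a ^+ i * a ^+ j.
  by rewrite -expgD -amod -[RHS]amod /= modn_mod.
have aN (i : 'Z_14) : a ^+ (- i)%R = a ^- i.
  by apply: (@mulgI _ (a ^+ i)); rewrite -aD addrN mulgV.
have az : a ^+ (7 : 'Z_14)%R = b * b by [].
have fM : {morph f : u v / u * v}.
  move=> [i s] [j t]; have fE k r : f (k, r) = a ^+ (k : nat) * b ^+ r by [].
  have -> : mul ((i, s) : Q28_model) (j, t) = Q28_mul (i, s) (j, t) by [].
  rewrite /Q28_mul !fE.
  case: s t => [] []; cbn [fst snd andb addb nat_of_bool];
    rewrite ?GRing.addr0 aD ?az ?aD ?aN ?expg0 ?expg1 ?mulg1 ?mulgA //.
  - by rewrite -[in RHS](mulgA _ b) ban !mulgA.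
  - by rewrite -[in RHS](mulgA _ b) ban mulgA.
pose F := HB.pack_for {multiplicative Q28_model -> H} f
  (isMultiplicative.Build _ _ f fM).
by exists F; rewrite /= /f /= ?expg0 ?mulg1 ?mul1g ?expg1.
Qed.

End ModelPresentation.

Section GroupRing.
Local Open Scope ring_scope.
Variables (R : nzRingType) (G : finGroupType).

(* R[G]: the function u stands for the formal sum of the terms u(g) g. *)
Definition group_ring : Type := {ffun G -> R}.
HB.instance Definition _ := GRing.Zmodule.on group_ring.

Definition gr_of (g : G) : group_ring := [ffun h => (h == g)%:R].

Definition gr_mul (u v : group_ring) : group_ring :=
  [ffun g => \sum_(h : G) u h * v (h^-1 * g)%g].

Let gr_mulA : associative gr_mul.
Proof.
move=> u v w; apply/ffunP=> g; rewrite !ffunE.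
under eq_bigr => h _ do
  rewrite ffunE (reindex_inj (mulgI h^-1%g)) mulr_sumr /=.
rewrite exchange_big /=; apply: eq_bigr => k _.
rewrite ffunE mulr_suml; apply: eq_bigr => h _.
by rewrite invMg invgK -!mulgA mulKVg mulrA.
Qed.

Let gr_mul1 : left_id (gr_of 1%g) gr_mul.
Proof.
move=> u; apply/ffunP=> g; rewrite !ffunE (bigD1 1%g) //= big1 => [|h /negPf hN].
  by rewrite ffunE eqxx mul1r invg1 mul1g addr0.
by rewrite ffunE hN mul0r.
Qed.

Let gr_mulr1 : right_id (gr_of 1%g) gr_mul.
Proof.
move=> u; apply/ffunP=> g; rewrite !ffunE (bigD1 g) //= big1 => [|h hN].
  by rewrite ffunE mulVg eqxx mulr1 addr0.
by rewrite ffunE -eq_mulVg1 (negPf hN) mulr0.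
Qed.

Let gr_mulDl : left_distributive gr_mul +%R.
Proof.
move=> u v w; apply/ffunP=> g; rewrite !ffunE -big_split /=.
by apply: eq_bigr => h _; rewrite ffunE mulrDl.
Qed.

Let gr_mulDr : right_distributive gr_mul +%R.
Proof.
move=> u v w; apply/ffunP=> g; rewrite !ffunE -big_split /=.
by apply: eq_bigr => h _; rewrite ffunE mulrDr.
Qed.

Let gr_1neq0 : gr_of 1%g != 0.
Proof.
apply/eqP=> /ffunP/(_ 1%g) /eqP.
by rewrite !ffunE eqxx oner_eq0.
Qed.

HB.instance Definition _ := GRing.Zmodule_isNzRing.Build group_ring
  gr_mulA gr_mul1 gr_mulr1 gr_mulDl gr_mulDr gr_1neq0.

Lemma gr_ofM (g h : G) : gr_of (g * h)%g = gr_of g * gr_of h.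
Proof.
apply/ffunP=> k; rewrite !ffunE (bigD1 g) //= big1 => [|l /negPf lN].
  by rewrite !ffunE eqxx mul1r addr0 (can2_eq (mulKVg g) (mulKg g)).
by rewrite ffunE lN mul0r.
Qed.

End GroupRing.

Section Modules.
Local Open Scope ring_scope.
Variable R : pzRingType.

Section Span.
Variables (M : lmodType R) (s : seq M).

Definition lspan : {pred M} :=
  [pred m | `[< exists c : 'I_(size s) -> R,
                  m = \sum_(i < size s) c i *: s`_i >]].

Let lspan_closed : submod_closed lspan.
Proof.
split=> [|a u v /asboolP[c ->] /asboolP[d ->]]; apply/asboolP.
  by exists (fun=> 0); rewrite big1 // => i _; rewrite scale0r.
exists (fun i => a * c i + d i); rewrite scaler_sumr -big_split /=.
by apply: eq_bigr => i _; rewrite scalerDl scalerA.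
Qed.

HB.instance Definition _ := GRing.isSubmodClosed.Build R M lspan lspan_closed.

Record span_module : Type :=
  SpanModule { span_val : M; span_valP : span_val \in lspan }.

HB.instance Definition _ := [isSub for span_val].
HB.instance Definition _ := [Choice of span_module by <:].
HB.instance Definition _ := [SubChoice_isSubLmodule of span_module by <:].

End Span.

Definition left_ideal (s : seq R) : lmodType R := @span_module R^o s.

Definition lmod_iso (M N : lmodType R) : Prop :=
  exists f : {linear M -> N}, bijective f.

Definition finitely_generated (M : lmodType R) : Prop :=
  exists s : seq M, forall m, m \in lspan s.

Definition stably_free (M : lmodType R) : Prop :=
  finitely_generated M /\
  exists r s : nat, lmod_iso (M * 'rV[R]_r)%type 'rV[R]_s.

(* M has a basis b, possibly infinite: each element of M is a linear combination
   of the b i for exactly one finitely supported family of coefficients. *)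
Definition free_module (M : lmodType R) : Prop :=
  exists (I : choiceType) (b : I -> M), forall m : M,
    exists! c : {fsfun I -> R with 0},
      m = \sum_(i <- finsupp c) c i *: b i.

End Modules.

(* Main.v *)
From HB Require Import structures.
Require Import Defs.
From mathcomp Require Import all_boot all_order all_algebra all_fingroup.
From mathcomp Require Import all_field.
From mathcomp Require Import finmap boolp ring zify.

(** Write Lam for the integral group ring and Phi(x) = (x^14 - 1) / (x + 1).
The quotient of Lam by x + 1 is the ring Z[i] of Gaussian integers (x acts as
-1 and y as i), the quotient by Phi is a ring Lam', and Lam is their fibre
product over (Z/14)[i], because Phi(-1) = -14.  The ideal P is the set of the
elements of Lam whose value in Z[i] is a multiple of -3 + 4i = (1 + 2i)^2.
Since that number is prime to 14, P is locally free of rank one: it glues Lam'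
to Z[i] along the unit -3 + 4i of (Z/14)[i].

Stably free.  The module P + Lam (direct sum) is free of rank two as soon as
the matrix diag(-3 + 4i, 1) over (Z/14)[i] is the product of the images of
invertible matrices over Lam' and over Z[i].  The key is the identity
gam tau = tau gam' with gam = 1 + y - y^-1, gam' = 1 - y + y^-1 and
tau = x - x^-1.  It says that right multiplication by tau maps Lam'/Lam' gam
isomorphically to Lam'/Lam' gam', and Schanuel's lemma then produces an
invertible 2 x 2 matrix over Lam' with first row (gam, tau).  Its value in
Z[i] is diag(1 + 2i, -3 (1 + 2i)), and -3 is the value of the unit
x - 1 + x^-1 of Lam', so that diag(1 + 2i, 1 + 2i) lifts to Lam' modulo 14;
elementary matrices turn it into diag((1 + 2i)^2, 1).  The outcome is the
explicit matrix [basis_mx], whose rows are a basis of P + Lam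
([coord_mx_basis_mx], [basis_mx_adj], [left_ideal_stably_free]).

Not free.  A free left ideal of Lam is principal
([free_left_ideal_principal]), so let b generate P.  A seventh root of unity w
gives a representation of Lam by complex matrices with rows (al, be) and
(- be^bar, al^bar), where al = p(w) and be = q(w) for integral polynomials p
and q that do not depend on w ([quat_rep_coords]); its determinant is
|al|^2 + |be|^2.  If w <> 1 the image of P contains 1, so that the image of b
is invertible; the product of its determinants over w = z, z^2, z^3 is then a
positive integer dividing 1.  But this product is at least the sum of the
integers prod |p(z^k)|^2 and prod |q(z^k)|^2, so that one of them vanishes.
These integers are congruent to p(1)^6 and q(1)^6 modulo 7
([real_cyclotomic_conj_prod]), whence 7 divides p(1) q(1)
([quat_norm_unit_dvd]).  For w = 1 on the other hand, p(1) + q(1) i generates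
the same ideal of Z[i] as -3 + 4i, hence p(1) and q(1) are -3, 3, -4 or 4 and
are prime to 7.  The units of the quaternion order thus reach only the classes
a and a i (a in F_7) of its residue field F_49 at 7, while P is glued along
4 + 4i. *)

Set Implicit Arguments.
Unset Strict Implicit.
Unset Printing Implicit Defensive.

Import Order.TTheory GRing.Theory Num.Theory.
Local Open Scope ring_scope.

(** * Computing with elements of the integral group ring *)

(** In this part a list of integers stands for a polynomial in x by increasing
    degree, and an exponent may exceed 13; [fold14] reduces it modulo
    x^14 - 1. *)
Fixpoint addp (a b : seq int) : seq int :=
  match a, b with
  | c :: a', d :: b' => c + d :: addp a' b'
  | [::], _ => b
  | _, [::] => a
  end.

Definition mulp (a b : seq int) : seq int :=
  foldr (fun c r => addp [seq c * d | d <- b] (0 :: r)) [::] a.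

Definition fold14 (a : seq int) : seq int :=
  foldr (fun c r => addp [:: c] (rotr 1 r)) (nseq 14 0) a.

(** The substitution of x^13 for x. *)
Definition conjp (a : seq int) : seq int :=
  foldr (fun c r => addp [:: c] (rot 1 r)) (nseq 14 0) a.

(** The pair (a, b) stands for a(x) + b(x) y. *)
Definition q28 : Type := (seq int * seq int)%type.

Definition qint (c : int) : q28 := ([:: c], [::]).
Definition qpol (a : seq int) : q28 := (a, [::]).
Definition qX n : q28 := (rcons (nseq n 0) 1, [::]).
Definition qY : q28 := ([::], [:: 1]).
Definition qadd (u v : q28) : q28 := (addp u.1 v.1, addp u.2 v.2).
(** From y b(x) = b(x^-1) y and y^2 = x^7. *)
Definition qmul (u v : q28) : q28 :=
  (fold14 (addp (mulp u.1 v.1) (nseq 7 0 ++ mulp u.2 (conjp v.2))),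
   fold14 (addp (mulp u.1 v.2) (mulp u.2 (conjp v.1)))).
Definition qopp (u : q28) : q28 := (map -%R u.1, map -%R u.2).
Definition qeq (u v : q28) : bool :=
  (fold14 u.1 == fold14 v.1) && (fold14 u.2 == fold14 v.2).

Section Evaluation.
Variables (R : nzRingType) (X Y : R).
Hypotheses (X14 : X ^+ 14 = 1) (YX : Y * X = X ^+ 13 * Y) (YY : Y * Y = X ^+ 7).

Definition evp (a : seq int) : R := foldr (fun c r => c%:~R + X * r) 0 a.
Definition evq (u : q28) : R := evp u.1 + evp u.2 * Y.

Lemma evp_add a b : evp (addp a b) = evp a + evp b.
Proof.
elim: a b => [|c a IH] [|d b] //=; rewrite ?add0r ?addr0 //.
by rewrite IH intrD mulrDr addrACA.
Qed.

Lemma evp_scale c a : evp [seq c * d | d <- a] = c%:~R * evp a.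
Proof.
elim: a => [|d a IH] /=; first by rewrite mulr0.
by rewrite IH mulrDr intrM !mulrA (commr_int X c).
Qed.

Lemma evp_mul a b : evp (mulp a b) = evp a * evp b.
Proof.
elim: a => [|c a IH] /=; first by rewrite mul0r.
by rewrite evp_add evp_scale /= add0r IH mulrDl mulrA.
Qed.

Lemma evp_shift n a : evp (nseq n 0 ++ a) = X ^+ n * evp a.
Proof.
elim: n => [|n IH] /=; first by rewrite mul1r.
by rewrite IH add0r mulrA exprS.
Qed.

Lemma evp_cat a b : evp (a ++ b) = evp a + X ^+ size a * evp b.
Proof.
elim: a => [|c a IH] /=; first by rewrite add0r mul1r.
by rewrite IH mulrDr addrA mulrA exprS.
Qed.

Lemma evp_rcons a c : evp (rcons a c) = evp a + X ^+ size a * c%:~R.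
Proof. by rewrite -cats1 evp_cat /= mulr0 addr0. Qed.

Lemma evp_rot a : size a = 14 -> evp (rot 1 a) = X ^+ 13 * evp a.
Proof.
case: a => // c a [sa]; rewrite rot1_cons evp_rcons sa /= mulrDr mulrA -exprSr.
by rewrite X14 mul1r addrC.
Qed.

Lemma evp_rotr a : size a = 14 -> evp (rotr 1 a) = X * evp a.
Proof.
move=> sa; rewrite -[in RHS](rotrK 1 a) evp_rot ?size_rotr // mulrA -exprS X14.
by rewrite mul1r.
Qed.

Lemma size_addp a b : size (addp a b) = maxn (size a) (size b).
Proof. by elim: a b => [|c a IH] [|d b] //=; rewrite IH maxnSS. Qed.

(** The list is kept at length 14, where multiplying by x is a rotation. *)
Lemma evp_fold14 a : evp (fold14 a) = evp a.
Proof.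
suff: size (fold14 a) = 14 /\ evp (fold14 a) = evp a by case.
elim: a => [|c a [sa ea]]; first by split; rewrite //= !(mulr0, addr0).
have -> : fold14 (c :: a) = addp [:: c] (rotr 1 (fold14 a)) by [].
by rewrite size_addp evp_add size_rotr sa evp_rotr // ea /= mulr0 addr0.
Qed.

Lemma evp_conj a : Y * evp a = evp (conjp a) * Y.
Proof.
suff: size (conjp a) = 14 /\ Y * evp a = evp (conjp a) * Y by case.
elim: a => [|c a [sa ea]]; first by split; rewrite //= !(mulr0, addr0, mul0r).
have -> : conjp (c :: a) = addp [:: c] (rot 1 (conjp a)) by [].
rewrite size_addp evp_add size_rot sa evp_rot //=; split=> //.
rewrite mulr0 addr0 mulrDr mulrDl mulrA YX -!mulrA ea; congr (_ + _).
by rewrite (commr_int Y c).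
Qed.

Lemma evqD u v : evq (qadd u v) = evq u + evq v.
Proof. by rewrite /evq /= !evp_add mulrDl addrACA. Qed.

Lemma evqM u v : evq (qmul u v) = evq u * evq v.
Proof.
have comX a : evp a * X ^+ 7 = X ^+ 7 * evp a.
  apply: commrX; elim: a => [|c a IH]; rewrite /GRing.comm /= ?mulr0 ?mul0r //.
  by rewrite mulrDl mulrDr -mulrA IH (commr_int X c).
rewrite /evq /qmul; cbn [fst snd].
rewrite !evp_fold14 !evp_add evp_shift !evp_mul.
move: (X ^+ 7) (YY) comX => Z YZ comZ.
have YB : evp u.2 * Y * (evp v.1 + evp v.2 * Y)
    = evp u.2 * evp (conjp v.1) * Y + Z * (evp u.2 * evp (conjp v.2)).
  rewrite mulrDr -!mulrA (evp_conj v.1); congr (_ + _).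
  by rewrite (mulrA Y) evp_conj -(mulrA _ Y) YZ comZ [LHS]mulrA comZ -mulrA.
by rewrite [RHS]mulrDl YB mulrDr mulrDl !mulrA addrAC !addrA.
Qed.

Lemma evq_int c : evq (qint c) = c%:~R.
Proof. by rewrite /evq /= mulr0 mul0r !addr0. Qed.

Lemma evq_eq u v : qeq u v -> evq u = evq v.
Proof.
case/andP=> /eqP e1 /eqP e2.
by rewrite /evq -evp_fold14 e1 -(evp_fold14 u.2) e2 !evp_fold14.
Qed.

Lemma evq_X n : evq (qX n) = X ^+ n.
Proof.
rewrite /evq mul0r addr0 /= evp_rcons size_nseq mulr1 -[nseq n 0]cats0.
by rewrite evp_shift mulr0 add0r.
Qed.

Lemma evq_Y : evq qY = Y.
Proof. by rewrite /evq /= mulr0 addr0 add0r mul1r. Qed.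

End Evaluation.

Declare Scope q28_scope.
Delimit Scope q28_scope with q28.
Local Notation "u + v" := (qadd u v) : q28_scope.
Local Notation "u - v" := (qadd u (qopp v)) : q28_scope.
Local Notation "- u" := (qopp u) : q28_scope.
Local Notation "u * v" := (qmul u v) : q28_scope.

Section Matrices.
Local Open Scope q28_scope.

Definition qmx : Type := ((q28 * q28) * (q28 * q28))%type.
Definition qmx_mul (A B : qmx) : qmx :=
  let: ((a11, a12), (a21, a22)) := A in
  let: ((b11, b12), (b21, b22)) := B in
  ((a11 * b11 + a12 * b21, a11 * b12 + a12 * b22),
   (a21 * b11 + a22 * b21, a21 * b12 + a22 * b22)).
Definition qmx_add (A B : qmx) : qmx :=
  let: ((a11, a12), (a21, a22)) := A in
  let: ((b11, b12), (b21, b22)) := B in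
  ((a11 + b11, a12 + b12), (a21 + b21, a22 + b22)).
Definition qmx_eq (A B : qmx) : bool :=
  let: ((a11, a12), (a21, a22)) := A in
  let: ((b11, b12), (b21, b22)) := B in
  [&& qeq a11 b11, qeq a12 b12, qeq a21 b21 & qeq a22 b22].
Definition qmx_diag a b : qmx := ((a, qint 0), (qint 0, b)).

Definition qmx_el12 c : qmx := ((qint 1, c), (qint 0, qint 1)).
Definition qmx_el21 c : qmx := ((qint 1, qint 0), (c, qint 1)).

End Matrices.

Section MatrixEvaluation.
Variables (R : nzRingType) (X Y : R).
Hypotheses (X14 : X ^+ 14 = 1) (YX : Y * X = X ^+ 13 * Y) (YY : Y * Y = X ^+ 7).
Let ev := evq X Y.

Lemma evq_qmx_mul (A B C : qmx) : qmx_eq (qmx_mul A B) C ->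
  (ev A.1.1 * ev B.1.1 + ev A.1.2 * ev B.2.1 = ev C.1.1) *
  (ev A.1.1 * ev B.1.2 + ev A.1.2 * ev B.2.2 = ev C.1.2) *
  (ev A.2.1 * ev B.1.1 + ev A.2.2 * ev B.2.1 = ev C.2.1) *
  (ev A.2.1 * ev B.1.2 + ev A.2.2 * ev B.2.2 = ev C.2.2).
Proof.
case: A B C => [[a11 a12] [a21 a22]] [[b11 b12] [b21 b22]].
move=> [[c11 c12] [c21 c22]].
case/and4P=> /(evq_eq Y X14) e1 /(evq_eq Y X14) e2.
move=> /(evq_eq Y X14) e3 /(evq_eq Y X14) e4.
by rewrite /= /ev -e1 -e2 -e3 -e4 !evqD !evqM.
Qed.

End MatrixEvaluation.

(** * Left ideals with two generators *)

Section Ideals.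
Variable R : nzRingType.

Lemma left_ideal2P (p1 p2 m : R) :
  reflect (exists a b, m = a * p1 + b * p2) (m \in @lspan R R^o [:: p1; p2]).
Proof.
apply: (iffP (asboolP _)) => [[c ->]|[a [b ->]]].
  exists (c ord0), (c (lift ord0 ord0)).
  by rewrite !big_ord_recl big_ord0 addr0.
exists (fun i => if i == 0%N :> nat then a else b).
by rewrite !big_ord_recl big_ord0 addr0.
Qed.

(** The inclusion of a left ideal in the ring, with the ring itself as codomain
    rather than its regular module. *)
Definition ideal_val (s : seq R) (m : left_ideal s) : R := span_val m.

Lemma ideal_val_inj s : injective (@ideal_val s).
Proof. exact: val_inj. Qed.

Lemma ideal_valZ s a (m : left_ideal s) : ideal_val (a *: m) = a * ideal_val m.
Proof. by []. Qed.

Lemma ideal_valD s (m n : left_ideal s) :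
  ideal_val (m + n) = ideal_val m + ideal_val n.
Proof. by []. Qed.

Lemma lmod_iso_of_bij (M N : lmodType R) (f : {linear M -> N}) :
  injective f -> (forall n, exists m, f m = n) -> lmod_iso N M.
Proof.
move=> f_inj f_surj.
have [g gK] := choice f_surj.
have fK : cancel f g by move=> m; apply: f_inj; rewrite gK.
have g_lin : linear g by move=> a u v; apply: f_inj; rewrite linearP !gK.
pose G := HB.pack_for {linear N -> M} g (GRing.isLinear.Build R N M _ g g_lin).
by exists G; exists f.
Qed.

Lemma left_ideal_fg (s : seq R) : finitely_generated (left_ideal s).
Proof.
have s_mem (i : 'I_(size s)) : s`_i \in @lspan R R^o s.
  apply/asboolP; exists (fun j => (j == i)%:R).
  rewrite (bigD1 i) //= eqxx scale1r big1 ?addr0 // => j /negPf ->.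
  by rewrite scale0r.
pose e i : left_ideal s := SpanModule (s_mem i).
exists [seq e i | i : 'I_(size s)] => -[m m_in]; apply/asboolP.
have /asboolP[c mE] := m_in.
have sz : size [seq e i | i : 'I_(size s)] = size s.
  by rewrite size_map size_enum_ord.
exists (fun i => c (cast_ord sz i)); apply: val_inj.
rewrite raddf_sum [LHS]mE /= (reindex (cast_ord sz)) /=; last first.
  by exists (cast_ord (esym sz)) => i _; rewrite ?cast_ordK ?cast_ordKV.
apply: eq_bigr => i _; congr (_ * _).
have i_lt : (i < size (enum 'I_(size s)))%N.
  by rewrite size_enum_ord (ltn_ord (cast_ord sz i)).
by rewrite (nth_map (cast_ord sz i)) //= (nth_ord_enum _ (cast_ord sz i)).
Qed.

Lemma rows_indep_of_right_adj (m11 m12 m21 m22 n11 n12 n21 n22 k : R) :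
    (forall v, v * k = 0 -> v = 0) ->
    m11 * n11 + m12 * n21 = k -> m11 * n12 + m12 * n22 = 0 ->
    m21 * n11 + m22 * n21 = 0 -> m21 * n12 + m22 * n22 = k ->
  forall v1 v2,
    v1 * m11 + v2 * m21 = 0 -> v1 * m12 + v2 * m22 = 0 -> v1 = 0 /\ v2 = 0.
Proof.
move=> k_reg N11 N12 N21 N22 v1 v2 e1 e2.
have adj n1 n2 : v1 * (m11 * n1 + m12 * n2) + v2 * (m21 * n1 + m22 * n2) = 0.
  by rewrite !mulrDr !mulrA addrACA -!mulrDl e1 e2 !mul0r addr0.
split; apply: k_reg.
  by have := adj n11 n21; rewrite N11 N21 mulr0 addr0.
by have := adj n12 n22; rewrite N12 N22 mulr0 add0r.
Qed.

Section RankTwoBasis.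
Variables (p1 p2 m11 m12 m21 m22 l11 l12 l21 l22 l31 l32 : R).
Let P := left_ideal [:: p1; p2].
Hypotheses (m11P : m11 \in @lspan R R^o [:: p1; p2])
           (m21P : m21 \in @lspan R R^o [:: p1; p2]).
Hypotheses (L11 : l11 * m11 + l12 * m21 = p1) (L12 : l11 * m12 + l12 * m22 = 0)
           (L21 : l21 * m11 + l22 * m21 = p2) (L22 : l21 * m12 + l22 * m22 = 0)
           (L31 : l31 * m11 + l32 * m21 = 0) (L32 : l31 * m12 + l32 * m22 = 1).
Hypothesis M_inj : forall v1 v2,
  v1 * m11 + v2 * m21 = 0 -> v1 * m12 + v2 * m22 = 0 -> v1 = 0 /\ v2 = 0.

(** The rows of the matrix (m_ij) lie in P + R by [m11P] and [m21P].  The rows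
    of (l_ij) are the coordinates of (p1, 0), (p2, 0) and (0, 1), which generate
    P + R; with [M_inj] this makes the rows of (m_ij) a basis. *)
Lemma left_ideal2_plus_free : lmod_iso (P * 'rV[R]_1)%type 'rV[R]_2.
Proof.
pose x1 : P := SpanModule m11P; pose x2 : P := SpanModule m21P.
pose f (v : 'rV[R]_2) : (P * 'rV[R]_1)%type :=
  (v 0 0 *: x1 + v 0 1 *: x2, const_mx (v 0 0 * m12 + v 0 1 * m22)).
have f_lin : linear f.
  move=> c v w; congr pair.
    by rewrite !mxE !scalerDl [RHS]/= scalerDr !scalerA addrACA.
  by apply/matrixP=> i j; rewrite [RHS]/= !mxE !mulrDl mulrDr !mulrA addrACA.
pose F := HB.pack_for {linear 'rV[R]_2 -> (P * 'rV[R]_1)%type} f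
  (GRing.isLinear.Build R _ _ _ f f_lin).
have fE v : F v = f v by [].
apply: (@lmod_iso_of_bij _ _ F).
  apply: (@raddf_inj _ _ F) => v fv0.
  have e1 : v 0 0 * m11 + v 0 1 * m21 = 0 := congr1 (fun q => val q.1) fv0.
  have /rowP/(_ 0) : const_mx (v 0 0 * m12 + v 0 1 * m22) = 0 :> 'rV[R]_1.
    by rewrite -[LHS]/(f v).2 (fv0 : f v = 0).
  rewrite !mxE => e2; have [v0 v1] := M_inj e1 e2.
  apply/rowP=> i; rewrite mxE.
  case: i => -[|[|//]] i.
    by rewrite -[RHS]v0; congr (v 0 _); apply: val_inj.
  by rewrite -[RHS]v1; congr (v 0 _); apply: val_inj.
move=> [[p pP] r]; have /left_ideal2P[a [b pE]] := pP; pose c := r 0 0.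
exists (\row_j if j == 0 then a * l11 + b * l21 + c * l31
               else a * l12 + b * l22 + c * l32).
have dist u11 u12 k1 k2 k3 k1' k2' k3' :
   (a * k1 + b * k2 + c * k3) * u11 + (a * k1' + b * k2' + c * k3') * u12 =
   a * (k1 * u11 + k1' * u12) + b * (k2 * u11 + k2' * u12)
   + c * (k3 * u11 + k3' * u12).
  by rewrite !mulrDl !mulrDr !mulrA addrACA [in LHS](addrACA (a * k1 * u11)).
rewrite [LHS]fE; congr pair.
  apply: val_inj; rewrite /= !mxE /= [RHS]pE.
  by rewrite [LHS]dist L11 L21 L31 mulr0 addr0.
apply/matrixP=> i j; rewrite !mxE /= dist L12 L22 L32 !mulr0 !add0r mulr1.
by rewrite !ord1.
Qed.

End RankTwoBasis.

End Ideals.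

(** * A basis of the direct sum of P and the group ring *)

Section BasisMatrix.
Local Open Scope q28_scope.

Definition gen_y : q28 := qint (-3) + qint 4 * qY.
Definition gen_x : q28 := qX 1 + qint 1.

(** (x^14 - 1) / (x + 1), which is central. *)
Definition Phi : q28 :=
  qpol [:: -1; 1; -1; 1; -1; 1; -1; 1; -1; 1; -1; 1; -1; 1]%Z.

(** As y^-1 = x^7 y, the element [gam] is 1 where x^7 = 1 and 1 + 2y where
    x^7 = -1: its reduced norm is 1 on the dihedral part and 5 on the
    quaternionic part, and [gam'] is its conjugate. *)
Definition gam : q28 := qint 1 + qY - qX 7 * qY.
Definition gam' : q28 := qint 1 - qY + qX 7 * qY.

(** x - x^-1, which satisfies gam tau = tau gam'. *)
Definition tau : q28 := qX 1 - qX 13.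

(** gam gam' sig - 7 (1 - x^7) = 1. *)
Definition sig : q28 := qint 2 - qX 7.

(** The solution of tau del = 7 (1 - x^7) modulo Phi that changes sign under
    x -> x^-1; it vanishes at x = -1. *)
Definition del : q28 :=
  qpol [:: 0; -3; -1; -2; -2; -1; -3; 0; 3; 1; 2; 2; 1; 3]%Z.

(** These matrices are inverse to each other modulo Phi: the diagonal products
    give gam gam' sig - tau del = 1, and the others cancel because
    gam tau = tau gam' and gam del = del gam'. *)
Definition schanuel_mx : qmx := ((gam, tau), (- del, - (sig * gam))).
Definition schanuel_mx_inv : qmx := ((gam' * sig, tau), (- del, - gam')).

(** x - 1 + x^-1, a unit modulo Phi since the sixth cyclotomic polynomial has
    resultant 1 with every factor of Phi. *)
Definition cyc6 : q28 := qX 1 - qint 1 + qX 13.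
Definition cyc6_inv : q28 :=
  qpol [:: 1; 0; 1; -1; 0; -1; 1; 0; 1; -1; 0; -1; 1; 0]%Z.

(** A lift of -3 + 6i, which is minus the inverse of 1 + 2i modulo 14. *)
Definition alp : q28 := qint 3 * (gam - qint 2).

(** At x = -1, y = i the first two factors give diag(1 + 2i, 1 + 2i) modulo 14
    and the product of the other two has rows (0, -(1 + 2i)^-1) and
    (1 + 2i, 1). *)
Definition basis_mod_Phi : qmx :=
  qmx_mul (qmx_mul (qmx_diag (qint 1) cyc6_inv) schanuel_mx)
          (qmx_mul (qmx_el12 alp) (qmx_el21 gam)).
Definition basis_mod_Phi_inv : qmx :=
  qmx_mul (qmx_mul (qmx_el21 (- gam)) (qmx_el12 (- alp)))
          (qmx_mul schanuel_mx_inv (qmx_diag (qint 1) cyc6)).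

(** The multiples of Phi shift the value at x = -1, y = i by multiples of 14, so
    as to make its rows exactly (0, -1) and (-3 + 4i, 1 + 2i).  This is a basis
    of the direct sum of (-3 + 4i) Z[i] and Z[i]. *)
Definition basis_mx : qmx :=
  qmx_add basis_mod_Phi (qmx_mul (qmx_diag Phi Phi)
    ((- qint 1 - qint 2 * qY, - qint 1),
     (qint 6 - qint 8 * qY, - qint 2 - qint 4 * qY))).

(** The coordinates of (-3 + 4y, 0) and (0, 1), corrected in the same way: their
    values at x = -1, y = i must be (1 + 2i, 1) and (-1, 0). *)
Definition coord_mx : qmx :=
  qmx_add (qmx_mul (qmx_diag gen_y (qint 1)) basis_mod_Phi_inv)
    (qmx_mul (qmx_diag Phi Phi)
      ((qint 1 + qint 2 * qY, qint 16), (- qint 1, qint 6 * qY - qint 3))).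

(** The coordinates of (x + 1, 0) and (0, 0); there is nothing to correct as
    (x + 1) Phi = 0. *)
Definition coord_mx_x : qmx :=
  qmx_mul (qmx_diag gen_x (qint 0)) basis_mod_Phi_inv.

(** (x^7 + 1) / (x + 1), the fourteenth cyclotomic polynomial. *)
Definition Phi14 : q28 := qpol [:: 1; -1; 1; -1; 1; -1; 1]%Z.

(** The coordinates of (25, 0) and (0, 25), from
    (-3 - 4y)(-3 + 4y) + 16 Phi14 (x + 1) = 25. *)
Definition basis_adj : qmx :=
  qmx_add (qmx_mul (qmx_diag (qint (-3) - qint 4 * qY) (qint 25)) coord_mx)
          (qmx_mul (qmx_diag (qint 16 * Phi14) (qint 0)) coord_mx_x).

(** Synthetic division by x + 1: quotient and remainder. *)
Definition div_xp1 (a : seq int) : seq int * int :=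
  foldr (fun c qr => (qr.2 :: qr.1, c - qr.2)%R) ([::], 0%R) a.

(** For u = v (x + 1), the factor v; the shift of the second component comes from
    (x + 1) y = x y (x + 1). *)
Definition qdiv_xp1 (u : q28) : q28 := ((div_xp1 u.1).1, 0 :: (div_xp1 u.2).1).

Lemma basis_mx11 : qeq basis_mx.1.1 (qdiv_xp1 basis_mx.1.1 * gen_x).
Proof. by vm_compute. Qed.

Lemma basis_mx21 :
  qeq basis_mx.2.1 (gen_y + qdiv_xp1 (basis_mx.2.1 - gen_y) * gen_x).
Proof. by vm_compute. Qed.

Lemma coord_mx_basis_mx :
  qmx_eq (qmx_mul coord_mx basis_mx) (qmx_diag gen_y (qint 1)).
Proof. by vm_compute. Qed.

Lemma coord_mx_x_basis_mx :
  qmx_eq (qmx_mul coord_mx_x basis_mx) (qmx_diag gen_x (qint 0)).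
Proof. by vm_compute. Qed.

(** The rows of [basis_mx] are independent because 25 is not a zero divisor. *)
Lemma basis_mx_adj :
  qmx_eq (qmx_mul basis_mx basis_adj) (qmx_diag (qint 25) (qint 25)).
Proof. by vm_compute. Qed.

End BasisMatrix.

Section StablyFree.
Variables (R : nzRingType) (X Y : R).
Hypotheses (X14 : X ^+ 14 = 1) (YX : Y * X = X ^+ 13 * Y) (YY : Y * Y = X ^+ 7).
Let ev := evq X Y.

Lemma evq_gen_y : ev gen_y = - 3 + 4 * Y.
Proof. by rewrite /ev evqD evqM // !evq_int evq_Y. Qed.

Lemma evq_gen_x : ev gen_x = X + 1.
Proof. by rewrite /ev evqD evq_int evq_X. Qed.

Lemma left_ideal_stably_free : (forall v : R, v * 25%:R = 0 -> v = 0) ->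
  stably_free (left_ideal [:: - 3 + 4 * Y; X + 1]).
Proof.
move=> tf; split; first exact: left_ideal_fg.
have evi c : ev (qint c) = c%:~R := evq_int X Y c.
have ep1 := evq_gen_y; have ep2 := evq_gen_x.
have m11 : ev basis_mx.1.1 = ev (qdiv_xp1 basis_mx.1.1) * (X + 1).
  by rewrite /ev (evq_eq Y X14 basis_mx11) evqM // -/ev ep2.
pose v21 := ev (qdiv_xp1 (basis_mx.2.1 - gen_y)%q28).
have m21 : ev basis_mx.2.1 = - 3 + 4 * Y + v21 * (X + 1).
  by rewrite /ev (evq_eq Y X14 basis_mx21) evqD evqM // -/ev ep1 ep2.
have [[[L11 L12] L31] L32] := evq_qmx_mul X14 YX YY coord_mx_basis_mx.
have [[[L21 L22] _] _] := evq_qmx_mul X14 YX YY coord_mx_x_basis_mx.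
have [[[N11 N12] N21] N22] := evq_qmx_mul X14 YX YY basis_mx_adj.
rewrite [RHS]ep1 in L11; rewrite [RHS]ep2 in L21.
rewrite [RHS]evi in L12; rewrite [RHS]evi in L22.
rewrite [RHS]evi in L31; rewrite [RHS]evi in L32.
rewrite [RHS]evi in N11; rewrite [RHS]evi in N12.
rewrite [RHS]evi in N21; rewrite [RHS]evi in N22.
exists 1%N, 2%N; apply: (left_ideal2_plus_free _ _ L11 L12 L21 L22 L31 L32).
- apply/left_ideal2P; exists 0, (ev (qdiv_xp1 basis_mx.1.1)).
  by rewrite mul0r add0r.
- by apply/left_ideal2P; exists 1, v21; rewrite mul1r.
exact: rows_indep_of_right_adj tf N11 N12 N21 N22.
Qed.

End StablyFree.

(** * The group of order 28 and its group ring *)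

Section Relations.
Local Open Scope group_scope.

Lemma Q28_relations_std (H : groupType) (a b : H) : Q28_relations a b ->
  [/\ a ^+ 14 = 1, b * a = a ^+ 13 * b & b * b = a ^+ 7].
Proof.
move=> [r1 r2].
have bb : b * b = a ^+ 7.
  apply/esym/eqP; rewrite -[b * b]/(b ^+ 2).
  by rewrite -(can_eq (mulgK (b ^- 2))) r1 mulgV.
have bab : b * a * b = a ^+ 6.
  by apply/eqP; rewrite -(can_eq (mulgK (a ^- 6))) r2 mulgV.
have ba : b * a = a^-1 * b.
  by apply: (@mulIg _ b); rewrite bab -mulgA bb (expgS a 6) mulKg.
have ban n : b * a ^+ n = a ^- n * b.
  elim: n => [|n IHn]; first by rewrite mulg1 invg1 mul1g.
  by rewrite expgSr mulgA IHn -mulgA ba mulgA -invgM -expgS expgSr.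
have a14 : a ^+ 14 = 1.
  have E : a ^- 7 = a ^+ 7.
    by apply: (@mulIg _ b); rewrite -ban -bb mulgA.
  by rewrite (expgD a 7 7) -{1}E mulVg.
split=> //; rewrite ba; congr (_ * _); apply: (@mulgI _ a).
by rewrite mulgV -expgS a14.
Qed.

End Relations.

Lemma presents_Q28_normal_form (G : finGroupType) (x y : G) :
  presents_Q28 x y -> forall g : G, exists i j : nat, g = (x ^+ i * y ^+ j)%g.
Proof.
move=> [gen /Q28_relations_std[x14 yx _] _] g.
have yNx : <[y]>%g \subset 'N(<[x]>)%g.
  rewrite cycle_subG -groupV inE -cycleJ cycle_subG conjgE invgK mulgA yx.
  by rewrite mulgK mem_cycle.
have : g \in (<[x]> * <[y]>)%g.
  rewrite -norm_joinEr // joing_idl joing_idr joingE.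
  by have -> := gen; rewrite inE.
by case/mulsgP=> _ _ /cycleP[i ->] /cycleP[j ->] ->; exists i, j.
Qed.

Lemma group_ring_relations (G : finGroupType) (x y : G) : presents_Q28 x y ->
  let X := gr_of int x in let Y := gr_of int y in
  [/\ X ^+ 14 = 1, Y * X = X ^+ 13 * Y & Y * Y = X ^+ 7].
Proof.
move=> [_ /Q28_relations_std[x14 yx yy] _] X Y.
have XE n : X ^+ n = gr_of int (x ^+ n)%g.
  by elim: n => [|n IH] //; rewrite exprS IH expgS gr_ofM.
by rewrite !XE -!gr_ofM x14 yx yy.
Qed.

Lemma group_ring_torsion_free (G : finGroupType) (n : nat)
    (v : group_ring int G) :
  v * n.+1%:R = 0 -> v = 0.
Proof.
rewrite mulr_natr => /ffunP v0; apply/ffunP=> g; have /eqP := v0 g.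
by rewrite ffunMnE ffunE mulrn_eq0 => /eqP.
Qed.

Lemma group_ring_intE (G : finGroupType) (n : int)
    (v : group_ring int G) h :
  (n%:~R * v) h = n * v h.
Proof.
rewrite mulrzl mulrC -mulrzz; case: n => n; first exact: ffunMnE.
by rewrite !NegzE !mulrNz ffunE; congr (- _); exact: ffunMnE.
Qed.

Lemma group_ring_sum (G : finGroupType) (u : group_ring int G) :
  u = \sum_g (u g)%:~R * gr_of int g.
Proof.
apply/ffunP=> h; rewrite sum_ffunE (bigD1 h) //= big1 => [|g /negPf gN].
  by rewrite addr0 group_ring_intE ffunE eqxx mulr1.
by rewrite group_ring_intE ffunE eq_sym gN mulr0.
Qed.

Section RingUnits.
Variable R : unitRingType.

(** The universal property of the presentation speaks of groups; this is the
    group to which it is applied. *)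
Record ring_units : Type :=
  RingUnit { ring_unit_val : R; _ : ring_unit_val \is a GRing.unit }.

HB.instance Definition _ := [isSub for ring_unit_val].
HB.instance Definition _ := [Choice of ring_units by <:].

Implicit Types u v : ring_units.

Definition ring_unit_one : ring_units := RingUnit (unitr1 R).

Let inv_subproof u : (val u)^-1 \is a GRing.unit.
Proof. by rewrite unitrV (valP u). Qed.
Definition ring_unit_inv u : ring_units := RingUnit (inv_subproof u).

Let mul_subproof u v : val u * val v \is a GRing.unit.
Proof. by rewrite unitrMl ?(valP u) ?(valP v). Qed.
Definition ring_unit_mul u v : ring_units := RingUnit (mul_subproof u v).

Let mulA : associative ring_unit_mul.
Proof. by move=> u v w; apply: val_inj; apply: mulrA. Qed.
Let mul1 : left_id ring_unit_one ring_unit_mul.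
Proof. by move=> u; apply: val_inj; apply: mul1r. Qed.
Let mulr1 : right_id ring_unit_one ring_unit_mul.
Proof. by move=> u; apply: val_inj; apply: mulr1. Qed.
Let mulV : left_inverse ring_unit_one ring_unit_inv ring_unit_mul.
Proof. by move=> u; apply: val_inj; apply: mulVr (valP u). Qed.
Let mulrV : right_inverse ring_unit_one ring_unit_inv ring_unit_mul.
Proof. by move=> u; apply: val_inj; apply: mulrV (valP u). Qed.

HB.instance Definition _ := isGroup.Build ring_units mulA mul1 mulr1 mulV mulrV.

End RingUnits.

Lemma group_ring_lift (G : finGroupType) (R : nzRingType) (f : G -> R) :
  f 1%g = 1 -> (forall g h, f (g * h)%g = f g * f h) ->
  exists F : {rmorphism group_ring int G -> R}, forall g, F (gr_of int g) = f g.
Proof.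
move=> f1 fM; pose F (u : group_ring int G) : R := \sum_g (u g)%:~R * f g.
have F_add : zmod_morphism F.
  move=> u v; rewrite /F -sumrB; apply: eq_bigr => g _.
  by rewrite !ffunE intrB mulrBl.
have F_of g : F (gr_of int g) = f g.
  rewrite /F (bigD1 g) //= big1 => [|h /negPf hN]; rewrite ffunE.
    by rewrite eqxx mul1r addr0.
  by rewrite hN mul0r.
have F_mul : monoid_morphism F.
  split=> [|u v]; first by rewrite -f1 -F_of.
  rewrite {1}/F [F u]/F mulr_suml.
  under eq_bigr => g _ do rewrite ffunE raddf_sum mulr_suml.
  rewrite exchange_big /=; apply: eq_bigr => h _.
  rewrite (reindex_inj (mulgI h)) /= /F mulr_sumr; apply: eq_bigr => k _.
  rewrite mulKg intrM fM -!mulrA; congr (_ * _).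
  by rewrite !mulrA; congr (_ * _); rewrite (commr_int (f h)).
by exists (HB.pack_for {rmorphism group_ring int G -> R} F
  (GRing.isZmodMorphism.Build _ _ F F_add)
  (GRing.isMonoidMorphism.Build _ _ F F_mul)).
Qed.

Lemma presents_Q28_lift (G : finGroupType) (x y : G) (R : unitRingType)
    (a b : R) :
    presents_Q28 x y -> a \is a GRing.unit -> b \is a GRing.unit ->
    a ^+ 7 = b ^+ 2 -> b * a * b = a ^+ 6 ->
  exists F : {rmorphism group_ring int G -> R},
    F (gr_of int x) = a /\ F (gr_of int y) = b.
Proof.
move=> [_ _ univ] ua ub a7 bab; pose a' := RingUnit ua; pose b' := RingUnit ub.
have valX (u : ring_units R) n : val (u ^+ n)%g = val u ^+ n.
  by elim: n => [|n IH] //; rewrite expgS exprS -IH.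
have [|f [fx fy]] := univ _ a' b'.
  have a7' : (a' ^+ 7 = b' ^+ 2)%g by apply: val_inj; rewrite !valX.
  have bab' : (b' * a' * b' = a' ^+ 6)%g by apply: val_inj; rewrite !valX.
  by rewrite /Q28_relations a7' bab' !mulgV.
pose g (h : G) : R := val (f h).
have g1 : g 1%g = 1.
  have f1 : f 1%g = 1%g by apply: (@mulgI _ (f 1%g)); rewrite -gmulfM !mulg1.
  by rewrite /g f1.
have gM h k : g (h * k)%g = g h * g k by rewrite /g gmulfM.
have [F FE] := group_ring_lift g1 gM.
by exists F; rewrite !FE /g fx fy.
Qed.

(** * Free left ideals are principal *)

Section FreeBasis.
Variables (R : nzRingType) (M : lmodType R) (I : choiceType) (b : I -> M).
Hypothesis b_basis : forall m : M, exists! c : {fsfun I -> R with 0},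
  m = \sum_(i <- finsupp c) c i *: b i.

Lemma basis_indep (A : {fset I}) (u : I -> R) :
  \sum_(k <- A) u k *: b k = 0 -> forall k, k \in A -> u k = 0.
Proof.
move=> u_sum; pose c : {fsfun I -> R with 0} := [fsfun k in A => u k].
have c_sum : 0 = \sum_(k <- finsupp c) c k *: b k.
  rewrite (big_fset_incl _ (finsupp_sub _ _ _)); last first.
    by move=> k _ /fsfun_dflt ->; rewrite scale0r.
  apply: etrans (esym u_sum) _; apply: eq_big_seq => k kA.
  by rewrite fsfun_fun kA.
pose z : {fsfun I -> R with 0} := [fsfun].
have z_sum : 0 = \sum_(k <- finsupp z) z k *: b k.
  by rewrite finsupp0 big_seq_fset0.
have [c' [_ c'_uniq]] := b_basis 0.
have cE : c = z by rewrite -(c'_uniq _ c_sum) -(c'_uniq _ z_sum).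
move=> k kA; have := congr1 (fun f : {fsfun I -> R with 0} => f k) cE.
by rewrite fsfun_fun kA fsfun0E.
Qed.

End FreeBasis.

Section NormElement.
Variable G : finGroupType.
Local Notation Lam := (group_ring int G).

Definition gr_norm : Lam := [ffun => 1].

Lemma gr_normM (u : Lam) : gr_norm * u = (\sum_g u g)%:~R * gr_norm.
Proof.
apply/ffunP=> g; rewrite group_ring_intE !ffunE mulr1.
rewrite (reindex_inj (inj_comp (mulgI g) invg_inj)) /=.
by apply: eq_bigr => h _; rewrite ffunE mul1r invMg invgK mulgKV.
Qed.

Lemma gr_norm_int_eq0 (n : int) : n%:~R * gr_norm = 0 -> n = 0.
Proof.
by move/ffunP/(_ 1%g); rewrite group_ring_intE !ffunE mulr1.
Qed.

(** The norm element nu satisfies nu u = e(u) nu for the augmentation e.  Hence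
    basis elements u and v obey the relation (e(v) nu) u - (e(u) nu) v = 0.  If
    they are distinct, independence forces e(u) = 0, so that nu u = 0, which
    contradicts independence again. *)
Lemma free_left_ideal_principal (s : seq Lam) : free_module (left_ideal s) ->
  exists b : left_ideal s, forall m, exists c, m = c *: b.
Proof.
move=> [I [b b_basis]].
have span m : exists c : {fsfun I -> Lam with 0},
    m = \sum_(i <- finsupp c) c i *: b i.
  by have [c [cE _]] := b_basis m; exists c.
have [[i0 _]|noI] := pselect (exists i : I, True); last first.
  exists 0 => m; exists 0; rewrite scaler0; have [c ->] := span m.
  by apply: big1 => i; case: noI; exists i.
pose e i := \sum_g ideal_val (b i) g.
have norm_b i : ideal_val (gr_norm *: b i) = (e i)%:~R * gr_norm.
  by rewrite ideal_valZ gr_normM.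
have only_i0 i : i = i0.
  apply: contrapT => /eqP ii0.
  pose u k := if k == i then (e i0)%:~R * gr_norm else - (e i)%:~R * gr_norm.
  have u_sum : \sum_(k <- [fset i; i0]%fset) u k *: b k = 0.
    rewrite big_fsetU1 ?inE //= big_seq_fset1 /u eqxx eq_sym (negPf ii0).
    rewrite -!scalerA.
    apply: ideal_val_inj; rewrite ideal_valD !ideal_valZ -!(ideal_valZ gr_norm).
    by rewrite !norm_b mulNr !mulrA -!intrM mulrC subrr.
  have /(_ i) := basis_indep b_basis u_sum; rewrite !inE eqxx /u eqxx.
  move=> /(_ isT)/gr_norm_int_eq0 e0.
  have n_sum : \sum_(k <- [fset i0]%fset) gr_norm *: b k = 0.
    by rewrite big_seq_fset1; apply: ideal_val_inj; rewrite norm_b e0 mul0r.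
  have /(_ i0) := basis_indep (u := fun=> gr_norm) b_basis n_sum.
  by rewrite inE eqxx => /(_ isT)/ffunP/(_ 1%g)/eqP; rewrite !ffunE oner_eq0.
exists (b i0) => m; have [c ->] := span m.
exists (\sum_(i <- finsupp c) c i); rewrite scaler_suml.
by apply: eq_bigr => i _; rewrite (only_i0 i).
Qed.

End NormElement.

(** * Norms of real cyclotomic integers *)

Section GaussPeriods.
Variable K : comNzRingType.
Implicit Types (F H : K -> K) (w z : K).

(** F takes the values of an integral combination of the Gauss periods w + w^-1,
    w^2 + w^-2, w^3 + w^-3 at the primitive seventh roots of unity, where the
    term in D vanishes.  At w = 1 that term is 7 D, which leaves F 1 determined
    modulo 7 by A, B and C. *)
Definition real_cyclotomic F : Prop := exists A B C D : int,
  forall w, w ^+ 7 = 1 ->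
    F w = A%:~R * (w + w ^+ 6) + B%:~R * (w ^+ 2 + w ^+ 5)
        + C%:~R * (w ^+ 3 + w ^+ 4) + D%:~R * (\sum_(i < 7) w ^+ i).

Lemma sum7 w : \sum_(i < 7) w ^+ i =
  1 + (w + w ^+ 6) + (w ^+ 2 + w ^+ 5) + (w ^+ 3 + w ^+ 4).
Proof. by rewrite !big_ord_recl big_ord0 /= /bump /=; ring. Qed.

Lemma real_cyclotomicD F H :
  real_cyclotomic F -> real_cyclotomic H ->
  real_cyclotomic (fun w => F w + H w).
Proof.
move=> [A [B [C [D FE]]]] [A' [B' [C' [D' HE]]]].
exists (A + A'), (B + B'), (C + C'), (D + D') => w w7.
by rewrite FE // HE // !intrD; ring.
Qed.

Lemma real_cyclotomicZ (c : int) F :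
  real_cyclotomic F -> real_cyclotomic (fun w => c%:~R * F w).
Proof.
move=> [A [B [C [D FE]]]]; exists (c * A), (c * B), (c * C), (c * D) => w w7.
by rewrite FE // !intrM; ring.
Qed.

Lemma eq_real_cyclotomic F H : (forall w, w ^+ 7 = 1 -> F w = H w) ->
  real_cyclotomic F -> real_cyclotomic H.
Proof.
move=> FH [A [B [C [D FE]]]]; exists A, B, C, D => w w7.
by rewrite -FH // FE.
Qed.

Lemma real_cyclotomic1 : real_cyclotomic (fun=> 1).
Proof. by exists (-1), (-1), (-1), 1 => w w7; rewrite sum7; ring. Qed.

Lemma real_cyclotomicX n : real_cyclotomic (fun w => w ^+ n + w ^+ (6 * n)).
Proof.
apply: (@eq_real_cyclotomic
  (fun w => w ^+ (n %% 7) + w ^+ ((6 * (n %% 7)) %% 7))).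
  by move=> w w7; rewrite modnMmr !expr_mod.
case: (n %% 7)%N (ltn_pmod n (isT : (0 < 7)%N)) => [|[|[|[|[|[|[|//]]]]]]] _ /=.
- by exists (-2), (-2), (-2), 2 => w w7; rewrite sum7; ring.
- by exists 1, 0, 0, 0 => w w7; ring.
- by exists 0, 1, 0, 0 => w w7; rewrite -[((6 * 2) %% 7)%N]/5%N; ring.
- by exists 0, 0, 1, 0 => w w7; rewrite -[((6 * 3) %% 7)%N]/4%N; ring.
- by exists 0, 0, 1, 0 => w w7; rewrite -[((6 * 4) %% 7)%N]/3%N; ring.
- by exists 0, 1, 0, 0 => w w7; rewrite -[((6 * 5) %% 7)%N]/2%N; ring.
- by exists 1, 0, 0, 0 => w w7; rewrite -[((6 * 6) %% 7)%N]/1%N; ring.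
Qed.

Definition evz (p : {poly int}) w : K := (map_poly intr p).[w].

Lemma evzC c w : evz c%:P w = c%:~R.
Proof. by rewrite /evz map_polyC hornerC. Qed.

Lemma evzX w : evz 'X w = w.
Proof. by rewrite /evz map_polyX hornerX. Qed.

Lemma evzD p q w : evz (p + q) w = evz p w + evz q w.
Proof. by rewrite /evz (rmorphD (map_poly intr)) hornerD. Qed.

Lemma evzM p q w : evz (p * q) w = evz p w * evz q w.
Proof. by rewrite /evz (rmorphM (map_poly intr)) hornerM. Qed.

Lemma evzN p w : evz (- p) w = - evz p w.
Proof. by rewrite /evz (rmorphN (map_poly intr)) hornerN. Qed.

Lemma evzXn n w : evz 'X^n w = w ^+ n.
Proof. by rewrite /evz map_polyXn hornerXn. Qed.

Lemma real_cyclotomic_trace p :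
  real_cyclotomic (fun w => evz p w + evz p (w ^+ 6)).
Proof.
(* Horner's induction on p multiplies the constant term by a power of X. *)
suff: forall n,
    real_cyclotomic (fun w => evz (p * 'X^n) w + evz (p * 'X^n) (w ^+ 6)).
  by move/(_ 0); rewrite expr0 mulr1.
elim/poly_ind: p => [|p c IH] n.
  have := real_cyclotomicZ 0 real_cyclotomic1.
  by apply: eq_real_cyclotomic => w _; rewrite mul0r -polyC0 !evzM !evzC; ring.
have := real_cyclotomicD (IH n.+1) (real_cyclotomicZ c (real_cyclotomicX n)).
apply: eq_real_cyclotomic => w _; rewrite exprM; move: (w ^+ 6) => v.
by rewrite !(evzM, evzD, evzC, evzX, evzXn) !exprS; ring.
Qed.

(** The cross terms in the product of p(w) + c by its conjugate are traces. *)
Lemma real_cyclotomic_norm p :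
  real_cyclotomic (fun w => evz p w * evz p (w ^+ 6)).
Proof.
elim/poly_ind: p => [|p c IH].
  have := real_cyclotomicZ 0 real_cyclotomic1.
  by apply: eq_real_cyclotomic => w _; rewrite mul0r -polyC0 !evzC mul0r.
have := real_cyclotomicD (real_cyclotomicD IH
  (real_cyclotomicZ c (real_cyclotomic_trace (p * 'X))))
  (real_cyclotomicZ (c * c) real_cyclotomic1).
apply: eq_real_cyclotomic => w w7.
rewrite !(evzM, evzD, evzC, evzX) intrM.
have -> : (evz p w * w + c%:~R) * (evz p (w ^+ 6) * w ^+ 6 + c%:~R)
  = evz p w * evz p (w ^+ 6) * w ^+ 7
  + c%:~R * (evz p w * w + evz p (w ^+ 6) * w ^+ 6) + c%:~R * c%:~R by ring.
by rewrite w7 !mulr1.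
Qed.

(** The hypotheses are the multiplication table of the three Gauss periods; the
    conclusion is the norm form of the cubic field that they generate. *)
Lemma period_norm (a b c A B C : K) :
  1 + a + b + c = 0 -> a * b = a + c -> b * c = a + b -> c * a = b + c ->
  a * a = b + 2 -> b * b = c + 2 -> c * c = a + 2 ->
  (A * a + B * b + C * c) * (A * b + B * c + C * a) * (A * c + B * a + C * b)
  = A ^+ 3 + B ^+ 3 + C ^+ 3 + 3 * (A ^+ 2 * B + B ^+ 2 * C + C ^+ 2 * A)
    - 4 * (A ^+ 2 * C + B ^+ 2 * A + C ^+ 2 * B) - A * B * C.
Proof.
move=> s0 ab bc ca aa bb cc.
have -> : (A * a + B * b + C * c) * (A * b + B * c + C * a) =
  A ^+ 2 * (a * b) + B ^+ 2 * (b * c) + C ^+ 2 * (c * a)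
  + A * B * (c * a + b * b) + A * C * (a * a + b * c) + B * C * (a * b + c * c).
  by ring.
have cE : c = - 1 - a - b by apply/eqP; rewrite -subr_eq0 -s0; apply/eqP; ring.
rewrite ab bc ca aa bb cc.
have -> : A ^+ 2 * (a + c) + B ^+ 2 * (a + b) + C ^+ 2 * (b + c)
   + A * B * (b + c + (c + 2)) + A * C * (b + 2 + (a + b))
   + B * C * (a + c + (a + 2))
   = (A ^+ 2 + B ^+ 2 - 2 * (A * B) - A * C) * a
   + (B ^+ 2 + C ^+ 2 - A * B - 2 * (B * C)) * b
   + (A ^+ 2 + C ^+ 2 - 2 * (A * C) - B * C) * c.
  by rewrite cE; ring.
have lin u v w : (u * a + v * b + w * c) * (A * c + B * a + C * b)
  = u * A * (b + c) + u * B * (b + 2) + u * C * (a + c)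
  + v * A * (a + b) + v * B * (a + c) + v * C * (c + 2)
  + w * A * (a + 2) + w * B * (b + c) + w * C * (a + b).
  by rewrite -ab -ca -bc -aa -bb -cc; ring.
by rewrite lin cE; ring.
Qed.

(** The conjugates under z -> z^2 -> z^3 permute the periods cyclically, so the
    product is the norm form at (A, B, C), which is (A + B + C)^3 modulo 7; and
    F 1 = 2 (A + B + C) + 7 D, where 2^3 = 1 modulo 7. *)
Lemma real_cyclotomic_conj_prod F z :
    real_cyclotomic F -> z ^+ 7 = 1 -> \sum_(i < 7) z ^+ i = 0 ->
  exists n m : int, [/\ F z * F (z ^+ 2) * F (z ^+ 3) = n%:~R,
    F 1 = m%:~R & (7 %| n - m ^+ 3)%Z].
Proof.
move=> [A [B [C [D FE]]]] z7 sum0.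
pose S := A + B + C; pose T := A ^+ 2 * C + B ^+ 2 * A + C ^+ 2 * B.
pose m := 2 * S + 7 * D.
pose n := A ^+ 3 + B ^+ 3 + C ^+ 3
  + 3 * (A ^+ 2 * B + B ^+ 2 * C + C ^+ 2 * A) - 4 * T - A * B * C.
exists n, m; split; last first.
- apply/dvdzP.
  exists (- (T + A * B * C) - S ^+ 3 - D * (m ^+ 2 + 2 * S * m + 4 * S ^+ 2)).
  by rewrite /n /m /T /S; ring.
- rewrite FE ?expr1n // sum7 !expr1n /m /S.
  by rewrite intrD !intrM !intrD; ring.
pose a := z + z ^+ 6; pose b := z ^+ 2 + z ^+ 5; pose c := z ^+ 3 + z ^+ 4.
have sum0' : 1 + a + b + c = 0 by rewrite -sum7.
have zM i j : z ^+ i ^+ j = z ^+ (i * j %% 7) by rewrite -exprM (expr_mod _ z7).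
have Fz : F z = A%:~R * a + B%:~R * b + C%:~R * c.
  by rewrite FE // sum0 mulr0 addr0.
have Fz2 : F (z ^+ 2) = A%:~R * b + B%:~R * c + C%:~R * a.
  rewrite FE ?sum7; last by rewrite exprAC z7 expr1n.
  have -> : z ^+ 2 ^+ 6 = z ^+ 5 by exact: zM.
  have -> : z ^+ 2 ^+ 2 = z ^+ 4 by exact: zM.
  have -> : z ^+ 2 ^+ 5 = z ^+ 3 by exact: zM.
  have -> : z ^+ 2 ^+ 3 = z ^+ 6 by exact: zM.
  have -> : z ^+ 2 ^+ 4 = z by exact: zM.
  have -> : 1 + (z ^+ 2 + z ^+ 5) + (z ^+ 4 + z ^+ 3) + (z ^+ 6 + z) = 0.
    by rewrite -sum0' /a /b /c; ring.
  by rewrite /a /b /c; ring.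
have Fz3 : F (z ^+ 3) = A%:~R * c + B%:~R * a + C%:~R * b.
  rewrite FE ?sum7; last by rewrite exprAC z7 expr1n.
  have -> : z ^+ 3 ^+ 6 = z ^+ 4 by exact: zM.
  have -> : z ^+ 3 ^+ 2 = z ^+ 6 by exact: zM.
  have -> : z ^+ 3 ^+ 5 = z by exact: zM.
  have -> : z ^+ 3 ^+ 3 = z ^+ 2 by exact: zM.
  have -> : z ^+ 3 ^+ 4 = z ^+ 5 by exact: zM.
  have -> : 1 + (z ^+ 3 + z ^+ 4) + (z ^+ 6 + z) + (z ^+ 2 + z ^+ 5) = 0.
    by rewrite -sum0' /a /b /c; ring.
  by rewrite /a /b /c; ring.
have ab : a * b = a + c.
  have -> : a * b = z ^+ 3 + z ^+ 6 + z ^+ 7 * (z + z ^+ 4).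
    by rewrite /a /b; ring.
  by rewrite z7 /a /c; ring.
have bc : b * c = a + b.
  have -> : b * c = z ^+ 5 + z ^+ 6 + z ^+ 7 * (z + z ^+ 2).
    by rewrite /c /b; ring.
  by rewrite z7 /a /b; ring.
have ca : c * a = b + c.
  have -> : c * a = z ^+ 4 + z ^+ 5 + z ^+ 7 * (z ^+ 2 + z ^+ 3).
    by rewrite /c /a; ring.
  by rewrite z7 /c /b; ring.
have aa : a * a = b + 2.
  have -> : a * a = z ^+ 2 + z ^+ 7 * (2 + z ^+ 5) by rewrite /a; ring.
  by rewrite z7 /b; ring.
have bb : b * b = c + 2.
  have -> : b * b = z ^+ 4 + z ^+ 7 * (2 + z ^+ 3) by rewrite /b; ring.
  by rewrite z7 /c; ring.
have cc : c * c = a + 2.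
  have -> : c * c = z ^+ 6 + z ^+ 7 * (2 + z) by rewrite /c; ring.
  by rewrite z7 /a; ring.
rewrite Fz Fz2 Fz3 (period_norm _ _ _ sum0' ab bc ca aa bb cc).
by rewrite /n /T; ring.
Qed.

End GaussPeriods.

Section NormInequality.
Implicit Types (p q r s : {poly int}) (w : algC).

(** w^6 is the complex conjugate of w. *)
Lemma evz_norm_ge0 p w : w ^+ 7 = 1 -> 0 <= evz p w * evz p (w ^+ 6).
Proof.
move=> w7; have -> : w ^+ 6 = w^*.
  have w0 : w != 0.
    by apply: contra_eq_neq w7 => ->; rewrite expr0n eq_sym oner_eq0.
  apply: (mulfI w0); rewrite -exprS w7 -normCK; apply/esym/eqP.
  by rewrite sqrp_eq1 ?normr_ge0 // -(@pexpr_eq1 _ _ 7) // -normrX w7 normr1.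
have -> : evz p w^* = (evz p w)^*.
  rewrite /evz -horner_map -map_poly_comp; congr _.[_].
  by apply: eq_map_poly => c /=; rewrite rmorph_int.
exact: mul_conjC_ge0.
Qed.

Lemma ge0_prod3D (R : numDomainType) (a b c a' b' c' : R) :
  0 <= a -> 0 <= b -> 0 <= c -> 0 <= a' -> 0 <= b' -> 0 <= c' ->
  a * b * c + a' * b' * c' <= (a + a') * (b + b') * (c + c').
Proof.
move=> *; rewrite -subr_ge0.
have -> : (a + a') * (b + b') * (c + c') - (a * b * c + a' * b' * c')
    = a * b * c' + a * b' * c + a * b' * c'
    + a' * b * c + a' * b * c' + a' * b' * c by ring.
by rewrite !addr_ge0 ?mulr_ge0.
Qed.

Definition quat_norm p q w : algC :=
  evz p w * evz p (w ^+ 6) + evz q w * evz q (w ^+ 6).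

Lemma evz1 p : evz p (1 : algC) = (p.[1])%:~R.
Proof. by rewrite /evz -[1 in LHS](rmorph1 intr) horner_map. Qed.

(** Otherwise the norms of p(z) and q(z) are not divisible by 7, hence they are
    positive integers, and the norm of |p(z)|^2 + |q(z)|^2 is at least 2; but it
    is an integer dividing 1. *)
Lemma quat_norm_unit_dvd p q r s :
    (forall w, w ^+ 7 = 1 -> w != 1 -> quat_norm p q w * quat_norm r s w = 1) ->
  (7 %| p.[1] * q.[1])%Z.
Proof.
move=> norm1; apply: contraT => p7.
have [z z_prim] := @C_prim_root_exists 7 isT; have z7 := prim_expr_order z_prim.
have zX k : z ^+ k ^+ 7 = 1 by rewrite exprAC z7 expr1n.
have z_neq1 k : ~~ (7 %| k)%N -> z ^+ k != 1.
  by rewrite (prim_order_dvd z_prim).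
have z_sum : \sum_(i < 7) z ^+ i = 0.
  have /eqP := subrX1 z 7; rewrite z7 subrr eq_sym mulf_eq0 subr_eq0.
  by rewrite -[z]expr1 (negPf (z_neq1 1%N _)) //= => /eqP.
have pos k r' : 0 <= evz r' (z ^+ k) * evz r' (z ^+ k ^+ 6).
  exact: evz_norm_ge0.
have pos1 r' : 0 <= evz r' z * evz r' (z ^+ 6) by apply: evz_norm_ge0.
have big r' : ~~ (7 %| r'.[1])%Z -> exists2 n : int, 1 <= n &
    (evz r' z * evz r' (z ^+ 6)) * (evz r' (z ^+ 2) * evz r' (z ^+ 2 ^+ 6)) *
    (evz r' (z ^+ 3) * evz r' (z ^+ 3 ^+ 6)) = n%:~R.
  move=> r7; have [n [m [nE mE nm]]] :=
    real_cyclotomic_conj_prod (real_cyclotomic_norm algC r') z7 z_sum.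
  exists n => //; rewrite -[_ <= _]/(0 < n) lt_def; apply/andP; split.
    apply: contra r7 => /eqP n0.
    have {}mE : m = r'.[1] ^+ 2.
      by apply: (@intr_inj algC); rewrite -mE expr1n evz1 rmorphXn.
    move: nm; rewrite n0 sub0r mE -exprM.
    by rewrite !dvdzE abszN abszX Euclid_dvdX // andbT.
  rewrite -(ler0z algC) -nE.
  by apply: mulr_ge0; [apply: mulr_ge0; [apply: pos1|]|]; apply: pos.
have /andP[p1 q1] : ~~ (7 %| p.[1])%Z && ~~ (7 %| q.[1])%Z.
  rewrite -negb_or; apply: contra p7 => /orP[] ?.
    exact: dvdz_mulr.
  exact: dvdz_mull.
have [n1 n1_ge n1E] := big p p1; have [n2 n2_ge n2E] := big q q1.
have prodE t u : exists n : int,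
    quat_norm t u z * quat_norm t u (z ^+ 2) * quat_norm t u (z ^+ 3) = n%:~R.
  have [n [m [nE _ _]]] := real_cyclotomic_conj_prod
    (real_cyclotomicD (real_cyclotomic_norm algC t)
      (real_cyclotomic_norm algC u)) z7 z_sum.
  by exists n.
have [n nE] := prodE p q; have [n' n'E] := prodE r s.
have n_ge : n1 + n2 <= n.
  rewrite -(ler_int algC) intrD -n1E -n2E -nE.
  by apply: ge0_prod3D;
    [apply: pos1|apply: pos|apply: pos|apply: pos1|apply: pos|apply: pos].
have nn' : n * n' = 1.
  apply: (@intr_inj algC); rewrite intrM -nE -n'E mulrACA.
  rewrite (mulrACA (quat_norm p q z)) (norm1 z z7).
    by rewrite (norm1 _ (zX 2%N)) ?(norm1 _ (zX 3%N)) ?z_neq1 ?mulr1.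
  by rewrite -[z]expr1 z_neq1.
have n2' : 2 <= n by lia.
by have [n'_le0|n'_gt0] := lerP n' 0; nia.
Qed.

End NormInequality.

(** * Representations by quaternion matrices *)

Section QuaternionMatrices.
Variable K : comUnitRingType.

(** The primed entries play the part of complex conjugates. *)
Definition quat_mx (a b a' b' : K) : 'M[K]_2 :=
  \matrix_(i, j) if i == 0 then (if j == 0 then a else b)
                 else if j == 0 then - b' else a'.

Lemma quat_mxD a b a' b' c d c' d' :
  quat_mx a b a' b' + quat_mx c d c' d'
  = quat_mx (a + c) (b + d) (a' + c') (b' + d').
Proof.
apply/matrixP=> i j; rewrite !mxE.
by case: ifP => _; case: ifP => _; rewrite ?opprD.
Qed.

Lemma quat_mxM a b a' b' c d c' d' :
  quat_mx a b a' b' * quat_mx c d c' d' =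
  quat_mx (a * c - b * d') (a * d + b * c')
          (a' * c' - b' * d) (a' * d' + b' * c).
Proof.
apply/matrixP=> i j; rewrite !mxE !big_ord_recl big_ord0 !mxE /=.
by case: ifP => _; case: ifP => _; ring.
Qed.

Lemma quat_mx_scalar c : quat_mx c 0 c 0 = c%:M.
Proof.
apply/matrixP=> i j; rewrite !mxE oppr0.
by case: i => -[|[|//]] ?; case: j => -[|[|//]] ? /=; rewrite ?mulr1n ?mulr0n.
Qed.

Lemma quat_mx_int (n : int) : n%:~R = quat_mx n%:~R 0 n%:~R 0.
Proof. by rewrite quat_mx_scalar -(rmorph_int (@scalar_mx K 2)). Qed.

Lemma quat_mx1 : quat_mx 1 0 1 0 = 1.
Proof. by rewrite quat_mx_scalar. Qed.

Lemma quat_mx0 : quat_mx 0 0 0 0 = 0.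
Proof. by rewrite quat_mx_scalar; apply: raddf0. Qed.

Lemma det_quat_mx a b a' b' : \det (quat_mx a b a' b') = a * a' + b * b'.
Proof.
rewrite (expand_det_row _ 0) !big_ord_recl big_ord0 /cofactor !det_mx11 !mxE /=.
by ring.
Qed.

(** With w^7 = 1, so that w^6 is the inverse of w, these matrices satisfy the
    relations of x and y. *)
Definition quat_mx_x (w : K) := quat_mx (- w) 0 (- w ^+ 6) 0.
Definition quat_mx_y := quat_mx 0 1 0 1.

Lemma quat_mx_diagX a a' n :
  quat_mx a 0 a' 0 ^+ n = quat_mx (a ^+ n) 0 (a' ^+ n) 0.
Proof.
elim: n => [|n IH]; first by rewrite !expr0 quat_mx_scalar.
by rewrite exprS IH quat_mxM !exprS; congr quat_mx; ring.
Qed.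

Lemma quat_mx_x_pow7 (w : K) : w ^+ 7 = 1 -> quat_mx_x w ^+ 7 = -1.
Proof.
move=> w7; have w67 : (w ^+ 6) ^+ 7 = 1 by rewrite exprAC w7 expr1n.
rewrite quat_mx_diagX (exprNn w) (exprNn (w ^+ 6)) w67 w7.
rewrite -[-1 in RHS]/(- 1%:M) -raddfN /= -quat_mx_scalar.
by congr quat_mx; ring.
Qed.

End QuaternionMatrices.

Section Representations.
Variables (G : finGroupType) (x y : G).
Hypothesis presG : presents_Q28 x y.
Local Notation Lam := (group_ring int G).
Local Notation X := (gr_of int x).
Local Notation Y := (gr_of int y).

Definition is_quat_rep (K : comUnitRingType) (w : K)
    (F : {rmorphism Lam -> 'M[K]_2}) : Prop :=
  F X = quat_mx_x w /\ F Y = quat_mx_y K.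

Lemma quat_rep_exists (K : comUnitRingType) (w : K) : w ^+ 7 = 1 ->
  exists F : {rmorphism Lam -> 'M[K]_2}, is_quat_rep w F.
Proof.
move=> w7.
have x7 := quat_mx_x_pow7 w7.
have y2 : quat_mx_y K ^+ 2 = -1.
  rewrite expr2 quat_mxM -[-1 in RHS]/(- 1%:M) -raddfN /= -quat_mx_scalar.
  by congr quat_mx; ring.
apply: presents_Q28_lift presG _ _ _ _; last 2 first.
- by rewrite x7 y2.
- rewrite quat_mx_diagX !quat_mxM; congr quat_mx; try ring.
  have w66 : w ^+ 6 ^+ 6 = w.
    by rewrite -exprM (exprD w (7 * 5) 1) exprM w7 expr1n mul1r.
  by rewrite (exprNn (w ^+ 6)) w66; ring.
- by rewrite -(@unitrX_pos _ _ 7) // x7 unitrN1.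
- by rewrite -(@unitrX_pos _ _ 2) // y2 unitrN1.
Qed.

(** Multiplying on the right by y replaces (p, q) by (- q, p), and multiplying on
    the left by x replaces it by (- X p, - X q); every element of G is x^i y^j. *)
Lemma quat_rep_coords (u : Lam) : exists p q : {poly int},
  forall (K : comUnitRingType) (w : K) F, w ^+ 7 = 1 -> is_quat_rep w F ->
  F u = quat_mx (evz p w) (evz q w) (evz p (w ^+ 6)) (evz q (w ^+ 6)).
Proof.
pose Q u := exists p q : {poly int},
  forall (K : comUnitRingType) (w : K) F, w ^+ 7 = 1 -> is_quat_rep w F ->
  F u = quat_mx (evz p w) (evz q w) (evz p (w ^+ 6)) (evz q (w ^+ 6)).
rewrite -/(Q u) (group_ring_sum u).
elim/big_ind: _ => [|a b [p [q pq]] [r [s rs]]|g _].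
- exists 0%:P, 0%:P => K w F _ _; rewrite rmorph0 !evzC.
  exact/esym/quat_mx0.
- exists (p + r), (q + s) => K w F w7 repF.
  by rewrite rmorphD (pq _ _ _ w7 repF) (rs _ _ _ w7 repF) quat_mxD !evzD.
have [i [j ->]] := presents_Q28_normal_form presG g.
have gr_ofX h n : gr_of int (h ^+ n)%g = gr_of int h ^+ n.
  by elim: n => [|n IH] //; rewrite expgS exprS gr_ofM IH.
have [p [q pq]] : Q (gr_of int (y ^+ j)%g).
  elim: j => [|j [p [q pq]]].
    exists 1%:P, 0%:P => K w F _ _; rewrite rmorph1 !evzC.
    exact/esym/quat_mx1.
  exists (- 1%:P * q), p => K w F w7 repF.
  rewrite expgSr gr_ofM rmorphM (pq _ _ _ w7 repF) repF.2.
  by rewrite quat_mxM !evzM !evzN !evzC; congr quat_mx; ring.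
have [r [s rs]] : Q (gr_of int (x ^+ i * y ^+ j)%g).
  elim: i => [|i [r [s rs]]]; first by exists p, q; rewrite mul1g.
  exists (- 1%:P * 'X * r), (- 1%:P * 'X * s) => K w F w7 repF.
  rewrite expgS -mulgA gr_ofM rmorphM (rs _ _ _ w7 repF) repF.1 quat_mxM.
  by rewrite !evzM !evzN !evzC !evzX; congr quat_mx; ring.
set c := u _; exists (c%:P * r), (c%:P * s) => K w F w7 repF.
rewrite rmorphM (rs _ _ _ w7 repF) rmorph_int quat_mx_int quat_mxM !evzM !evzC.
by congr quat_mx; ring.
Qed.

End Representations.

(** * The ideal is not free *)

(** The two factors are the real and imaginary parts of (p + q i)(-3 + 4i), where
    p + q i is a unit of Z[i]. *)
Lemma gaussian_unit_multiple_ndvd7 (p q : int) : p ^+ 2 + q ^+ 2 = 1 ->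
  ~~ (7 %| (-3 * p - 4 * q) * (4 * p - 3 * q))%Z.
Proof.
rewrite !expr2 => pq1.
have [p1 q1] : -1 <= p <= 1 /\ -1 <= q <= 1 by split; nia.
have [[-> ->]|[[-> ->]|[[-> ->]|[-> ->]]]] :
    (p = 1 /\ q = 0) \/ (p = -1 /\ q = 0) \/
    (p = 0 /\ q = 1) \/ (p = 0 /\ q = -1) by nia.
all: by vm_compute.
Qed.

Lemma gen_x_mul_Phi14 : qeq (qmul gen_x Phi14) (qadd (qX 7) (qint 1)).
Proof. by vm_compute. Qed.

(** Modulo Phi14, that is on the quaternionic part, (-3 - 4y)(-3 + 4y) is 25 and
    a multiple of x + 1 is -7; the combination is 2 * 25 - 7 * 7 = 1. *)
Definition bezout_y : q28 := (qint 2 * (qint (-3) - qint 4 * qY))%q28.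
Definition bezout_x : q28 := qpol [:: -42; 35; -28; 21; -14; 7]%Z.
Definition bezout_Phi14 : q28 := (qint (-25) - qint 32 * qX 1)%q28.

Lemma bezout_gen :
  qeq (bezout_y * gen_y + bezout_x * gen_x)%q28
      (qint 1 + bezout_Phi14 * Phi14)%q28.
Proof. by vm_compute. Qed.

Section NotFree.
Variables (G : finGroupType) (x y : G).
Hypothesis presG : presents_Q28 x y.
Local Notation Lam := (group_ring int G).
Local Notation X := (gr_of int x).
Local Notation Y := (gr_of int y).

(** The representations at w <> 1 factor through the quotient by Phi14, since
    (x + 1) Phi14 = x^7 + 1 is mapped to 0 and x + 1 to an invertible matrix. *)
Lemma bezout_rep : exists u v : Lam, forall (w : algC) F,
    w ^+ 7 = 1 -> w != 1 -> is_quat_rep x y w F ->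
  F (u * (- 3 + 4 * Y) + v * (X + 1)) = 1.
Proof.
have [X14 YX YY] := group_ring_relations presG.
pose ev := evq X Y; exists (ev bezout_y), (ev bezout_x) => w F w7 w1 [FX FY].
have evi c : ev (qint c) = c%:~R := evq_int X Y c.
have p1E : ev gen_y = - 3 + 4 * Y := evq_gen_y X14 YX YY.
have p2E : ev gen_x = X + 1 := evq_gen_x _ _.
have x_unit : F (X + 1) \is a GRing.unit.
  rewrite rmorphD rmorph1 FX -quat_mx1 quat_mxD unitmxE det_quat_mx.
  rewrite unitfE !addr0 mulr0 addr0 mulf_neq0 // addrC subr_eq0 eq_sym //.
  apply: contra w1 => /eqP w6; apply/eqP.
  by rewrite -w7 exprS w6 mulr1.
have Phi0 : F (ev Phi14) = 0.
  apply: (mulrI x_unit); rewrite mulr0 -rmorphM -p2E -evqM //.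
  have -> : evq X Y (qmul gen_x Phi14) = X ^+ 7 + 1.
    by rewrite (evq_eq Y X14 gen_x_mul_Phi14) evqD -/ev evi [ev _]evq_X.
  rewrite rmorphD rmorph1 rmorphXn FX quat_mx_x_pow7 //.
  exact: addNr.
rewrite -p1E -p2E -!evqM // -evqD (evq_eq Y X14 bezout_gen) evqD evqM //.
by rewrite -/ev evi rmorphD rmorphM Phi0 mulr0 addr0 rmorph1.
Qed.

Lemma left_ideal_not_free :
  ~ free_module (left_ideal [:: - 3 + 4 * Y; X + 1]).
Proof.
move=> /free_left_ideal_principal[b b_gen].
have gen m : m \in @lspan Lam Lam^o [:: - 3 + 4 * Y; X + 1] ->
    exists c, m = c * ideal_val b.
  move=> mP; have [c cE] := b_gen (SpanModule mP).
  by exists c; rewrite -ideal_valZ -cE.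
have [p [q bE]] := quat_rep_coords presG (ideal_val b).
have [u [v uv1]] := bezout_rep.
have [c cE] : exists c, u * (- 3 + 4 * Y) + v * (X + 1) = c * ideal_val b.
  by apply: gen; apply/left_ideal2P; exists u, v.
have [r [s rsE]] := quat_rep_coords presG c.
have norm_prim (w : algC) : w ^+ 7 = 1 -> w != 1 ->
    quat_norm p q w * quat_norm r s w = 1.
  move=> w7 w1; have [F repF] := quat_rep_exists presG w7.
  have := congr1 determinant (uv1 w F w7 w1 repF).
  rewrite cE rmorphM det_mulmx det1 (bE _ _ _ w7 repF) (rsE _ _ _ w7 repF).
  by rewrite !det_quat_mx mulrC.
have := quat_norm_unit_dvd norm_prim; apply/negP.
(* The representation at w = 1 factors through Z[i]: it maps x + 1 to 0. *)
have one7 : (1 : algC) ^+ 7 = 1 by rewrite expr1n.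
have [F repF] := quat_rep_exists presG one7.
have [c1 [c2 bval]] : exists c1 c2,
    ideal_val b = c1 * (- 3 + 4 * Y) + c2 * (X + 1).
  exact/left_ideal2P/(span_valP b).
have [d dE] : exists d, - 3 + 4 * Y = d * ideal_val b.
  by apply: gen; apply/left_ideal2P; exists 1, 0; rewrite mul1r mul0r addr0.
have Fx : F (X + 1) = 0.
  rewrite rmorphD rmorph1 repF.1 /quat_mx_x -quat_mx1 quat_mxD.
  by rewrite expr1n addNr addr0; exact: quat_mx0.
have Fy : F (- 3 + 4 * Y) = quat_mx (-3) 4 (-3) 4.
  rewrite rmorphD rmorphN rmorphM repF.2 !rmorph_nat.
  have -> : - 3 = (-3)%:~R :> 'M[algC]_2 by rewrite mulrNz.
  rewrite (quat_mx_int algC (-3)) [4%:R](quat_mx_int algC 4) quat_mxM quat_mxD.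
  by congr quat_mx; ring.
have [k [l klE]] := quat_rep_coords presG c1.
have [m [n mnE]] := quat_rep_coords presG d.
have Fb : F (ideal_val b) = F c1 * quat_mx (-3) 4 (-3) 4.
  by rewrite bval rmorphD !rmorphM Fx Fy mulr0 addr0.
have coordE :
    p.[1] = -3 * k.[1] - 4 * l.[1] /\ q.[1] = 4 * k.[1] - 3 * l.[1].
  move: Fb; rewrite (bE _ _ _ one7 repF) (klE _ _ _ one7 repF) quat_mxM.
  rewrite expr1n !evz1 => /matrixP E; have := E 0 0; have := E 0 1.
  rewrite !mxE /= => E1 E0.
  by split; apply: (@intr_inj algC); rewrite ?E0 ?E1; ring.
have norm1 : (m.[1] ^+ 2 + n.[1] ^+ 2) * (k.[1] ^+ 2 + l.[1] ^+ 2) = 1.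
  have := congr1 determinant (congr1 F dE).
  rewrite rmorphM Fb Fy (klE _ _ _ one7 repF) (mnE _ _ _ one7 repF) !det_mulmx.
  rewrite !det_quat_mx expr1n !evz1 mulrA => e25.
  apply: (@intr_inj algC); apply: (@mulIf algC 25); first by rewrite pnatr_eq0.
  have -> : 25 = -3 * -3 + 4 * 4 :> algC by ring.
  by rewrite mul1r [RHS]e25 !expr2; ring.
rewrite coordE.1 coordE.2; apply: gaussian_unit_multiple_ndvd7.
have sqr_ge (i j : int) : 0 <= i ^+ 2 + j ^+ 2.
  by rewrite addr_ge0 ?sqr_ge0.
have mul1 (i j : int) : 0 <= i -> 0 <= j -> i * j = 1 -> j = 1.
  move=> i0 j0 ij; have i1 : 1 <= i by nia.
  by nia.
exact: mul1 (sqr_ge _ _) (sqr_ge _ _) norm1.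
Qed.

End NotFree.

Theorem theorem3p1 (G : finGroupType) (x y : G) (presG : presents_Q28 x y) :
  let P := left_ideal [:: - 3 + 4 * gr_of int y; gr_of int x + 1] in
  stably_free P /\ ~ free_module P.
Proof.
move=> P; split; last exact: left_ideal_not_free presG.
have [X14 YX YY] := group_ring_relations presG.
exact/left_ideal_stably_free/group_ring_torsion_free.
Qed.
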